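(* There exist positive constants $c_1,c_2$ such that for all positive integers $n$ and $S$ for which $M(n,S)$ is nonempty, $$c_1\le\frac{\max M(n,S)}{\max M_4(n,S)}\le c_2,$$ i.e. $\max M(n,S)\asymp\max M_4(n,S)$ with implied constants independent of $n$ and $S$.
   Context: The continuant $\langle a_1,\ldots,a_n\rangle$ is defined by $\langle\,\rangle=1$, $\langle a_1\rangle=a_1$, $\langle a_1,\ldots,a_n\rangle=a_n\langle a_1,\ldots,a_{n-1}\rangle+\langle a_1,\ldots,a_{n-2}\rangle$. For a sequence $A=(a_1,\ldots,a_n)$ of positive integers let $S^{\varphi}_n(A)=\sum_{i=1}^n a_i(\frac32+\frac12(-1)^i)=a_1+2a_2+a_3+2a_4+\cdots$. $M(n,S)$ is the set of sequences of positive integers of length $n$ with $S^{\varphi}_n(A)=S$, and $\max M(n,S)$ denotes the maximum of $\langle A\rangle$ over $A\in M(n,S)$. $M_4(n,S)\subseteq M(n,S)$ is the set of those $A$ for which there exist positive integers $a,b$ with $a_i\in\{a,a+1\}$ for all odd $i$ and $a_i\in\{b,b+1\}$ for all even $i$; $\max M_4(n,S)$ is the maximum of $\langle A\rangle$ over this set. *)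

(* Defs.v *)
From mathcomp Require Import all_boot.
Set Implicit Arguments. Unset Strict Implicit. Unset Printing Implicit Defensive.

(* Continuant, computed on the REVERSED sequence so that the defining
   recursion <a_1..a_n> = a_n <a_1..a_{n-1}> + <a_1..a_{n-2}> is structural. *)
Fixpoint contr (r : seq nat) : nat :=
  match r with
  | [::] => 1
  | [:: a] => a
  | an :: ((an1 :: rest) as r') => an * contr r' + contr rest
  end.

Definition cont (A : seq nat) : nat := contr (rev A).

(* S^phi_n(A) = a_1 + 2 a_2 + a_3 + 2 a_4 + ... ; 0-based index j corresponds
   to i = j+1, weight 3/2 + (-1)^i/2 = 1 if i odd, 2 if i even. *)
Definition Sphi (A : seq nat) : nat :=
  \sum_(j < size A) (nth 0 A j) * (if odd j then 2 else 1).

Definition inM (n S : nat) (A : seq nat) : bool :=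
  [&& size A == n, all (fun x => 0 < x) A & Sphi A == S].

(* the M_4 condition: exist positive a, b with a_i in {a,a+1} for odd i
   (1-based) and a_i in {b,b+1} for even i.  For A in M(n,S) every entry is
   <= S, so restricting a, b to 0..S loses nothing (a <= a_1 <= S; if n = 1,
   b = 1 works). *)
Definition M4cond (S : nat) (A : seq nat) : bool :=
  [exists a : 'I_S.+1, exists b : 'I_S.+1,
     [&& 0 < (a : nat), 0 < (b : nat) &
      all (fun j => if odd j then (nth 0 A j == b) || (nth 0 A j == b.+1)
                    else (nth 0 A j == a) || (nth 0 A j == a.+1))
          (iota 0 (size A))]].

Definition inM4 (n S : nat) (A : seq nat) : bool := inM n S A && M4cond S A.

(* all sequences of length n with entries in 1..S (contains M(n,S)) *)
Fixpoint candidates (n S : nat) : seq (seq nat) :=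
  match n with
  | 0 => [:: [::]]
  | m.+1 => [seq x :: t | x <- iota 1 S, t <- candidates m S]
  end.

(* max M(n,S) and max M_4(n,S) (0 if the set is empty) *)
Definition maxM (n S : nat) : nat :=
  \max_(A <- candidates n S | inM n S A) cont A.
Definition maxM4 (n S : nat) : nat :=
  \max_(A <- candidates n S | inM4 n S A) cont A.

(* Main.v *)
Require Import Defs.
From mathcomp Require Import all_boot zify.
Set Implicit Arguments. Unset Strict Implicit. Unset Printing Implicit Defensive.

(** Take [A] in M(n,S) maximizing the continuant and, among the maximizers, minimizing
the sum of squares. As a function of two entries [x], [y] the continuant is
[al x y + (r+s) x + (p+q) y + de], where [p/al], [q/al] (resp. [r/al], [s/al]) are the
continued fractions read off to the left and right of [x] (resp. of [y]). So the effect
of the moves [(x-1, y+1)] within a parity class, and [(x-2, z+1)], [(x+2, z-1)] across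
classes (weight 1 for [x], weight 2 for [z]), is governed by the neighbouring entries,
and none of them may help at [A]. This forces the weight-2 entries of [A] to differ by
at most 1, the weight-1 entries by at most 2, and by at most 1 away from the two ends.
Hence at most two moves [(x-1, y+1)] bring [A] into M_4(n,S), and each at most halves the
continuant: the ratio lies in [1, 4]. *)

(** * Continuants as entries of products of 2x2 matrices *)

Definition contr_behead (s : seq nat) : nat := if s is _ :: t then contr t else 0.

Fixpoint contr_belast (s : seq nat) : nat :=
  match s with
  | [::] => 0
  | [:: _] => 1
  | x :: ((_ :: t) as s') => x * contr_belast s' + contr_belast t
  end.

(** Completes the matrix with rows [(K, E)] and [(D, F)], the product over [s] of the matrices with
    rows [(x, 1)] and [(1, 0)]. The values on [[::]] are those of the identity matrix. *)
Definition contr_inner (s : seq nat) : nat :=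
  if s is _ :: t then contr_belast t else 1.

Local Notation K := contr.
Local Notation D := contr_behead.
Local Notation E := contr_belast.
Local Notation F := contr_inner.

Lemma contr_cons x t : K (x :: t) = x * K t + D t.
Proof. by case: t => [|y t] //=; rewrite muln1 addn0. Qed.

Lemma contr_belast_cons x t : E (x :: t) = x * E t + F t.
Proof. by case: t => [|y t] //=; rewrite muln0. Qed.

(** First column of the matrix product for [s ++ t]. The two entries are proved together because [D]
    of a longer list is [K] of its tail. *)
Lemma contr_cat_behead_cat s t :
  K (s ++ t) = K s * K t + E s * D t /\ D (s ++ t) = D s * K t + F s * D t.
Proof.
elim: s => [|x s [IHK IHD]]; first by rewrite /= !mul1n !mul0n addn0.
by rewrite cat_cons contr_cons IHK IHD [K (x :: s)]contr_cons contr_belast_cons /= IHK; lia.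
Qed.

Lemma contr_cat s t : K (s ++ t) = K s * K t + E s * D t.
Proof. by case: (contr_cat_behead_cat s t). Qed.

Lemma contr_behead_cat s t : D (s ++ t) = D s * K t + F s * D t.
Proof. by case: (contr_cat_behead_cat s t). Qed.

Lemma contr_belast_inner_rcons s x : E (rcons s x) = K s /\ F (rcons s x) = D s.
Proof.
elim: s => [|y s [IHE IHF]] //.
by rewrite rcons_cons contr_belast_cons contr_cons IHE IHF.
Qed.

(** The factors are symmetric, so reversal transposes the matrix. The induction has to carry all
    four entries. *)
Lemma contr_rev_behead_rev s : K (rev s) = K s /\ D (rev s) = E s.
Proof.
suff [-> -> _ _] : [/\ K (rev s) = K s, D (rev s) = E s, E (rev s) = D s & F (rev s) = F s] by [].
elim: s => [|x s [IHK IHD IHE IHF]] //.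
rewrite rev_cons; have [-> ->] := contr_belast_inner_rcons (rev s) x.
rewrite -cats1 contr_cat contr_behead_cat [K (x :: s)]contr_cons contr_belast_cons.
rewrite IHK IHE IHD IHF /=.
by split=> //; lia.
Qed.

Lemma contr_rev s : K (rev s) = K s.
Proof. by case: (contr_rev_behead_rev s). Qed.

Lemma contr_behead_rev s : D (rev s) = E s.
Proof. by case: (contr_rev_behead_rev s). Qed.

(** * Bounds for quotients of continuants *)

Lemma contr_gt0 s : all (fun x => 0 < x) s -> 0 < K s.
Proof. by elim: s => // x s IH /andP[x0 /IH]; rewrite contr_cons; nia. Qed.

Lemma contr_behead_le s : all (fun x => 0 < x) s -> D s <= K s.
Proof. by case: s => // x s /= /andP[x0 _]; rewrite -/(K (x :: s)) contr_cons; nia. Qed.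

(** [K s / D s] is the continued fraction with partial quotients [s], hence at least its first one;
    for empty [s], [D s] is 0. *)
Lemma contr_behead_mul_le c s : (0 < size s -> c <= nth 0 s 0) -> c * D s <= K s.
Proof.
case: s => [|x s] /= h; first by lia.
by rewrite -/(K (x :: s)) contr_cons; have := h isT; nia.
Qed.

Lemma contr_le_behead_mul c s :
  all (fun x => 0 < x) s -> 0 < size s -> nth 0 s 0 <= c -> K s <= c.+1 * D s.
Proof.
case: s => [|x s] //= /andP[_ s0] _ xc.
by rewrite -/(K (x :: s)) contr_cons; have := contr_behead_le s0; nia.
Qed.

(** Here [K s / D s] is [x + 1/(y + t)] with [x >= 1], [y <= c] and [t <= 1], so it is at least
    [1 + 1/(c+1)]. *)
Lemma contr_behead_le_second c s :
  all (fun x => 0 < x) s -> 1 < size s -> nth 0 s 1 <= c -> c.+2 * D s <= c.+1 * K s.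
Proof.
case: s => [|x [|y s]] //= /and3P[x0 y0 s0] _ yc.
rewrite -/(K (y :: s)) contr_cons.
by have := contr_behead_le s0; have := contr_gt0 s0; nia.
Qed.

(* [p / al] is the value of the continued fraction read off [A] from position [i]
   outwards on one side, over [m] entries; the bounds only involve its first two
   partial quotients, whose indices have the parity opposite to [i] and that of [i]. *)
Definition side_bounds (A : seq nat) (i al p m : nat) : Prop :=
  [/\ forall c, (forall k, k < size A -> odd k != odd i -> c <= nth 0 A k) -> c * p <= al,
      forall c, 0 < m -> (forall k, k < size A -> odd k != odd i -> nth 0 A k <= c) ->
        al <= c.+1 * p,
      forall c, 1 < m -> (forall k, k < size A -> odd k = odd i -> nth 0 A k <= c) ->
        c.+2 * p <= c.+1 * al &
      m = 0 -> p = 0].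

(** The equation says [p / al = D s / K s], with [s] read outwards from position [i]; the bounds on
    [D s / K s] carry over after multiplying by [K s]. *)
Lemma side_boundsP A i al p s :
    all (fun x => 0 < x) s -> p * K s = al * D s ->
    (0 < size s -> exists2 k, k < size A /\ odd k != odd i & nth 0 s 0 = nth 0 A k) ->
    (1 < size s -> exists2 k, k < size A /\ odd k = odd i & nth 0 s 1 = nth 0 A k) ->
  side_bounds A i al p (size s).
Proof.
move=> s0 e h0 h1; have Ks := contr_gt0 s0; split; try move=> c.
- move=> h; have : c * D s <= K s.
    by apply: contr_behead_mul_le => /h0[k [? ?] ->]; apply: h.
  by move=> h'; rewrite -(leq_pmul2r Ks); nia.
- move=> m0 h; have : K s <= c.+1 * D s.
    by apply: contr_le_behead_mul => //; have [k [? ?] ->] := h0 m0; apply: h.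
  by move=> h'; rewrite -(leq_pmul2r Ks); nia.
- move=> m1 h; have : c.+2 * D s <= c.+1 * K s.
    by apply: contr_behead_le_second => //; have [k [? ?] ->] := h1 m1; apply: h.
  by move=> h'; rewrite -(leq_pmul2r Ks); nia.
- by move: c e Ks => /size0nil-> /=; lia.
Qed.

(** * The continuant as a function of two entries *)

Definition upd2 (A : seq nat) (i x j y : nat) := set_nth 0 (set_nth 0 A i x) j y.

(* [p, q] belong to position [i], [r, s] to position [j]; [q] and [s] come from the
   block between the two positions. *)
Definition bilinear_at (A : seq nat) (i j : nat) : Prop :=
  exists al p q r s de mi mj,
  [/\ 0 < al,
      forall x y, K (upd2 A i x j y) = al * (x * y) + (r + s) * x + (p + q) * y + de,
      side_bounds A i al p mi /\ side_bounds A i al q (i - j + (j - i)).-1,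
      side_bounds A j al r mj /\ side_bounds A j al s (i - j + (j - i)).-1 &
      [/\ 1 < i < (size A).-2 -> 1 < mi,
          1 < j < (size A).-2 -> 1 < mj &
          (i - j + (j - i)).-1 = 1 -> q = s]].

(** Write [A] as [L], [x], [M], [y], [R] and expand the continuant by concatenation. *)
Lemma bilinear_at_lt A i j :
  all (fun x => 0 < x) A -> i < j -> j < size A -> bilinear_at A i j.
Proof.
move=> A0 ij jn.
pose L := take i A; pose M := take (j - i.+1) (drop i.+1 A); pose R := drop j.+1 A.
have sL : size L = i by apply: size_takel; lia.
have sM : size M = j - i.+1 by apply: size_takel; rewrite size_drop; lia.
have sR : size R = size A - j.+1 by rewrite size_drop.
have defA : A = L ++ nth 0 A i :: M ++ nth 0 A j :: R.
  have -> : M ++ nth 0 A j :: R = drop i.+1 A.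
    rewrite -[RHS](cat_take_drop (j - i.+1)) drop_drop subnK //.
    by rewrite -drop_nth.
  by rewrite -drop_nth ?cat_take_drop //; lia.
have updE x y : upd2 A i x j y = L ++ x :: M ++ y :: R.
  apply: (@eq_from_nth _ 0).
    by rewrite !size_set_nth !size_cat /= size_cat /= sL sM sR; lia.
  move=> k _; rewrite !nth_set_nth /= nth_set_nth /= {1}defA.
  rewrite !nth_cat /= sL.
  have [->|kj] := eqVneq k j.
    rewrite ltnNge (ltnW ij) /=; case e: (j - i) => [|d]; first by lia.
    by rewrite /= nth_cat sM (_ : d = j - i.+1) ?ltnn ?subnn //; lia.
  have [->|ki] := eqVneq k i; first by rewrite ltnn subnn.
  case: ltnP => // ik; case e: (k - i) => [|d]; first by lia.
  rewrite /= !nth_cat sM; case: ltnP => // dd.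
  by case e': (d - _) => [|u] //; lia.
have : all (fun x => 0 < x) (L ++ nth 0 A i :: M ++ nth 0 A j :: R) by rewrite -defA.
rewrite all_cat /= all_cat /= => /and5P[L0 i0 M0 j0 R0].
have nL k : k < i -> nth 0 (rev L) k = nth 0 A (i - k.+1).
  by move=> ki; rewrite nth_rev sL // nth_take //; lia.
have nM k : k < j - i.+1 -> nth 0 M k = nth 0 A (i.+1 + k).
  by move=> ki; rewrite nth_take // nth_drop.
have nrM k : k < j - i.+1 -> nth 0 (rev M) k = nth 0 A (j - k.+1).
  by move=> ki; rewrite nth_rev sM // nM; [congr nth; lia | lia].
have nR k : nth 0 R k = nth 0 A (j.+1 + k) by rewrite nth_drop.
(* Relative to [al], the numbers [p], [q], [r], [s] are [E L / K L], [D M / K M], [D R / K R] and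
   [E M / K M]. *)
exists (K L * K M * K R), (E L * K M * K R), (K L * D M * K R), (K L * K M * D R),
  (K L * E M * K R), (K L * (D M * D R + F M * K R) + E L * (K M * D R + E M * K R)), i, (size A - j.+1).
have -> : (i - j + (j - i)).-1 = j - i.+1 by lia.
have KL := contr_gt0 L0; have KM := contr_gt0 M0; have KR := contr_gt0 R0.
split; first by rewrite !muln_gt0 KL KM KR.
- move=> x y; rewrite updE contr_cat contr_cons /= contr_cat contr_behead_cat contr_cons /=.
  by lia.
- split.
    rewrite -{2}sL -(size_rev L); apply: side_boundsP; rewrite ?all_rev //.
    - by rewrite contr_rev contr_behead_rev; lia.
    - by rewrite size_rev sL => h; exists (i - 1); [lia | rewrite nL].
    - by rewrite size_rev sL => h; exists (i - 2); [lia | rewrite nL].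
  rewrite -sM; apply: side_boundsP => //; first by lia.
  - by rewrite sM => h; exists (i.+1 + 0); [lia | rewrite nM].
  - by rewrite sM => h; exists (i.+1 + 1); [lia | rewrite nM].
- split.
    rewrite -sR; apply: side_boundsP => //; first by lia.
    - by rewrite sR => h; exists (j.+1 + 0); [lia | rewrite nR].
    - by rewrite sR => h; exists (j.+1 + 1); [lia | rewrite nR].
  rewrite -sM -(size_rev M); apply: side_boundsP; rewrite ?all_rev //.
  - by rewrite contr_rev contr_behead_rev; lia.
  - by rewrite size_rev sM => h; exists (j - 1); [lia | rewrite nrM].
  - by rewrite size_rev sM => h; exists (j - 2); [lia | rewrite nrM].
split; [lia | lia |].
(* A block of a single entry has [D M = E M = 1]. *)
by rewrite -sM; case: (M) => [|m [|? ?]].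
Qed.

(** Either order of the positions is allowed: with truncated subtraction, [(i - j + (j - i)).-1]
    counts the entries strictly between them in both cases. *)
Lemma bilinear_atP A i j :
  all (fun x => 0 < x) A -> i < size A -> j < size A -> i != j -> bilinear_at A i j.
Proof.
move=> A0 iA jA ij; case: (ltnP i j) => [|ji]; first by move/bilinear_at_lt; apply.
have {}ji : j < i by lia.
have [al [p [q [r [s [de [mi [mj [al0 f [hp hq] [hr hs] [h1 h2 h3]]]]]]]]]] := bilinear_at_lt A0 ji iA.
have e : i - j + (j - i) = j - i + (i - j) by lia.
exists al, r, s, p, q, de, mj, mi; rewrite e; split=> //.
  by move=> x y; rewrite /upd2 set_set_nth (negPf ij) f; lia.
by split=> // /h3.
Qed.

(** * Changing two entries within M(n,S) *)

Lemma size_upd2 A i x j y : i < size A -> j < size A -> size (upd2 A i x j y) = size A.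
Proof. by rewrite /upd2 !size_set_nth => *; lia. Qed.

Lemma nth_upd2 A i x j y k : nth 0 (upd2 A i x j y) k =
  if k == j then y else if k == i then x else nth 0 A k.
Proof. by rewrite /upd2 nth_set_nth /= nth_set_nth. Qed.

Lemma upd2_id A i j : i < size A -> j < size A -> upd2 A i (nth 0 A i) j (nth 0 A j) = A.
Proof.
move=> iA jA; apply: (@eq_from_nth _ 0); first by rewrite size_upd2.
by move=> k _; rewrite nth_upd2; case: eqP => [->|_] //; case: eqP => [->|].
Qed.

(** Serves both the weighted sum [Sphi] and the sum of squares; old terms stand on the left to avoid
    truncated subtraction. *)
Lemma sum_upd2 (g : nat -> nat -> nat) A i x j y :
    i < size A -> j < size A -> i != j ->
  \sum_(k < size (upd2 A i x j y)) g k (nth 0 (upd2 A i x j y) k) + (g i (nth 0 A i) + g j (nth 0 A j))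
  = \sum_(k < size A) g k (nth 0 A k) + (g i x + g j y).
Proof.
move=> iA jA ij; rewrite size_upd2 //.
have ji : Ordinal jA != Ordinal iA by rewrite eq_sym.
rewrite (bigD1 (Ordinal iA)) //= (bigD1 (Ordinal jA)) //=.
rewrite [in RHS](bigD1 (Ordinal iA)) //= [in RHS](bigD1 (Ordinal jA)) //=.
rewrite !nth_upd2 !eqxx (negPf ij).
rewrite (eq_bigr (fun k : 'I_(size A) => g k (nth 0 A k))); first by lia.
move=> k /andP[ki kj]; rewrite nth_upd2.
by move: ki kj; rewrite -!val_eqE /= => /negPf-> /negPf->.
Qed.

Lemma inM_all n S A : inM n S A -> all (fun x => 0 < x) A.
Proof. by case/and3P. Qed.

Lemma inM_size n S A : inM n S A -> size A = n.
Proof. by case/and3P => /eqP. Qed.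

Lemma inM_nth_gt0 n S A k : inM n S A -> k < n -> 0 < nth 0 A k.
Proof. by move=> AM kn; apply: (all_nthP 0 (inM_all AM)); rewrite (inM_size AM). Qed.

Lemma inM_nth_le n S A k : inM n S A -> nth 0 A k <= S.
Proof.
case/and3P => _ _ /eqP <-; case: (ltnP k (size A)) => [kA|kA]; last by rewrite nth_default.
by rewrite /Sphi (bigD1 (Ordinal kA)) //=; case: odd; lia.
Qed.

Lemma inM_upd2 n S A i x j y :
    inM n S A -> i < n -> j < n -> i != j -> 0 < x -> 0 < y ->
    x * (if odd i then 2 else 1) + y * (if odd j then 2 else 1) =
    nth 0 A i * (if odd i then 2 else 1) + nth 0 A j * (if odd j then 2 else 1) ->
  inM n S (upd2 A i x j y).
Proof.
case/and3P => /eqP sA A0 /eqP SA iA jA ij x0 y0 e; rewrite -sA in iA jA.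
rewrite /inM size_upd2 // sA eqxx /=; apply/andP; split.
  apply/(all_nthP 0) => k; rewrite size_upd2 // nth_upd2 => kA.
  by case: eqP => // _; case: eqP => // _; apply: (all_nthP 0 A0).
rewrite /Sphi; have := @sum_upd2 (fun k v => v * (if odd k then 2 else 1)) A i x j y iA jA ij.
by rewrite -/(Sphi A) SA => h; apply/eqP; move: h; rewrite -/(Sphi _); lia.
Qed.

(** * Optimal sequences and their existence *)

Definition sumsq (A : seq nat) := \sum_(k < size A) nth 0 A k ^ 2.

Definition optimal n S A :=
  [/\ inM n S A, forall B, inM n S B -> K B <= K A &
      forall B, inM n S B -> K B = K A -> sumsq A <= sumsq B].

Lemma candidatesP n S A : inM n S A -> A \in candidates n S.
Proof.
move=> AM; have sA := inM_size AM.
have : forall k, k < n -> 0 < nth 0 A k <= S.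
  by move=> k kn; rewrite (inM_nth_gt0 AM kn) (inM_nth_le _ AM).
elim: n A sA {AM} => [|n IH] [|x A] //= [sA] h.
apply/allpairsP; exists (x, A); split => //=.
  by rewrite mem_iota; have := h 0 isT; rewrite /=; lia.
by apply: IH => // k kn; apply: (h k.+1).
Qed.

Lemma sumsq_le n S A : inM n S A -> sumsq A <= n * S ^ 2.
Proof.
move=> AM; rewrite -(inM_size AM) /sumsq.
rewrite -[X in _ <= X * _]card_ord -sum_nat_const.
by apply: leq_sum => k _; rewrite leq_exp2r // (inM_nth_le _ AM).
Qed.

Lemma optimal_exists n S A : inM n S A -> exists B, optimal n S B.
Proof.
(* Since [sumsq B <= N], maximizing [f] is the lexicographic choice: largest [K] first, then
   smallest [sumsq]. *)
move=> AM; pose N := n * S ^ 2; pose f B := K B * N.+1 + (N - sumsq B).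
pose g := [pred k | has (fun B => inM n S B && (f B == k)) (candidates n S)].
have gf B : inM n S B -> g (f B).
  by move=> BM; apply/hasP; exists B; rewrite ?candidatesP // BM eqxx.
have gex : exists k, g k by exists (f A); exact: gf.
have gb k : g k -> k <= \max_(B <- candidates n S | inM n S B) f B.
  by case/hasP => B Bc /andP[BM /eqP <-]; apply: leq_bigmax_seq.
case: (ex_maxnP gex gb) => k /hasP[B Bc /andP[BM /eqP fB]] kmax.
have fmax C : inM n S C -> f C <= f B by move=> CM; rewrite fB; apply/kmax/gf.
have NB := sumsq_le BM; rewrite -/N in NB.
exists B; split=> // C CM; have := fmax C CM; have := sumsq_le CM; rewrite -/N /f.
  by nia.
by move=> NC + e; rewrite e; lia.
Qed.

(** * Exchange moves at an optimum and the spread of the entries *)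

(** The move stays in M(n,S) and strictly lowers the sum of squares, so a tie of continuants would
    contradict the second minimality. *)
Lemma optimal_shift n S A i j :
    optimal n S A -> i < n -> j < n -> odd i = odd j -> nth 0 A j + 2 <= nth 0 A i ->
  K (upd2 A i (nth 0 A i).-1 j (nth 0 A j).+1) < K A.
Proof.
move=> [AM Amax Amin] iA jA eij le.
have ij : i != j by apply: contraTneq le => ->; lia.
set B := upd2 _ _ _ _ _.
have BM : inM n S B by apply: inM_upd2 => //; [lia | rewrite eij; case: odd; lia].
have := Amax B BM; rewrite leq_eqVlt => /orP[/eqP e|//].
have := Amin B BM e; have := inM_size AM => sA; rewrite -sA in iA jA.
have := @sum_upd2 (fun _ v => v ^ 2) A i (nth 0 A i).-1 j (nth 0 A j).+1 iA jA ij.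
rewrite -/B -/(sumsq A) -/(sumsq B) -!mulnn.
by move: (nth 0 A i) (nth 0 A j) le => [|x] y /=; nia.
Qed.

(** Indices start at 0, so even [i] has weight 1 and odd [j] has weight 2. *)
Lemma optimal_cross n S A i x j y :
    optimal n S A -> i < n -> j < n -> ~~ odd i -> odd j -> 0 < x -> 0 < y ->
    x + 2 * y = nth 0 A i + 2 * nth 0 A j ->
  K (upd2 A i x j y) <= K A.
Proof.
move=> [AM Amax _] iA jA oi oj x0 y0 e; apply/Amax/inM_upd2 => //.
  by apply: contraNneq oi => ->.
by rewrite (negPf oi) oj; lia.
Qed.

Lemma optimal_odd_spread n S A i j :
    optimal n S A -> i < n -> j < n -> odd i -> odd j -> nth 0 A i <= nth 0 A j + 1.
Proof.
move=> Aopt iA jA oi oj; rewrite leqNgt; apply/negP => lt.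
have [AM _ _] := Aopt; have sA := inM_size AM; have A0 := inM_all AM.
have eij : odd i = odd j by rewrite oi oj.
have le : nth 0 A j + 2 <= nth 0 A i by lia.
have bad := optimal_shift Aopt iA jA eij le.
have ij : i != j by apply: contraTneq le => ->; lia.
have [iA' jA'] : i < size A /\ j < size A by rewrite sA.
(* If some weight-1 entry is 1, replace [(1, v)] by [(3, v-1)], where [v >= 3] is the entry at [i].
   The gain [al(2v-3) + 2(r+s) - (p+q)] is at least [al(2v-5) > 0]. *)
case: (boolP [exists k : 'I_n, ~~ odd k && (nth 0 A k == 1)]) => [/existsP[k /andP[ok /eqP k1]]|no].
  have kA : (k : nat) < size A by rewrite sA.
  have ki : nat_of_ord k != i by apply: contraNneq ok => ->.
  have c := @optimal_cross n S A k 3 i (nth 0 A i).-1 Aopt (ltn_ord k) iA ok oi isT.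
  have {}c : K (upd2 A k 3 i (nth 0 A i).-1) <= K A by apply: c; lia.
  have [al [p [q [r [s [de [mi [mj [al0 f [hp hq] [hr hs] _]]]]]]]]] := bilinear_atP A0 kA iA' ki.
  move: c; rewrite -[X in _ <= K X](upd2_id kA iA') !f k1.
  have p1 : 1 * p <= al by case: hp => h _ _ _; apply: h => l lA _; rewrite (inM_nth_gt0 AM) // -sA.
  have q1 : 1 * q <= al by case: hq => h _ _ _; apply: h => l lA _; rewrite (inM_nth_gt0 AM) // -sA.
  have : 3 <= nth 0 A i by have := inM_nth_gt0 AM jA; lia.
  by move: (nth 0 A i) => [//|x] /= x3; have : al * 2 <= al * x; nia.
(* Otherwise [r] and [s] are at most [al/2], and the shift from [v] to [w] (the entry at [j]) gains
   [al(v-w-1) + (p+q) - (r+s) >= 0]. *)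
have P2 k : k < size A -> odd k != odd j -> 2 <= nth 0 A k.
  rewrite sA oj => kA ok; have := inM_nth_gt0 AM kA.
  move/existsPn/(_ (Ordinal kA)): no => /=; move: ok; case: odd => //= _; lia.
have [al [p [q [r [s [de [mi [mj [al0 f _ [[hr _ _ _] [hs _ _ _]] _]]]]]]]]] := bilinear_atP A0 iA' jA' ij.
move: bad; rewrite -[X in _ < K X](upd2_id iA' jA') !f.
have := hr _ P2; have := hs _ P2.
by move: (nth 0 A i) (nth 0 A j) le => [|x] y /=; nia.
Qed.

(** For a gap of 3 or more the shift would gain at least [2al - (r+s)], which is nonnegative because
    [r] and [s] are at most [al]. *)
Lemma optimal_even_spread n S A i j :
    optimal n S A -> i < n -> j < n -> ~~ odd i -> ~~ odd j -> nth 0 A i <= nth 0 A j + 2.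
Proof.
move=> Aopt iA jA oi oj; rewrite leqNgt; apply/negP => lt.
have [AM _ _] := Aopt; have sA := inM_size AM; have A0 := inM_all AM.
have eij : odd i = odd j by rewrite (negPf oi) (negPf oj).
have le : nth 0 A j + 2 <= nth 0 A i by lia.
have bad := optimal_shift Aopt iA jA eij le.
have ij : i != j by apply: contraTneq le => ->; lia.
have [iA' jA'] : i < size A /\ j < size A by rewrite sA.
have P1 k : k < size A -> odd k != odd j -> 1 <= nth 0 A k.
  by rewrite sA => kA _; apply: inM_nth_gt0 AM kA.
have [al [p [q [r [s [de [mi [mj [al0 f _ [[hr _ _ _] [hs _ _ _]] _]]]]]]]]] := bilinear_atP A0 iA' jA' ij.
move: bad; rewrite -[X in _ < K X](upd2_id iA' jA') !f.
have := hr _ P1; have := hs _ P1.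
by move: (nth 0 A i) (nth 0 A j) lt => [|x] y /=; nia.
Qed.

(** Interior positions have at least two entries on their outer side, which makes the finer bounds
    on [p] and [r] available. *)
Lemma optimal_even_interior n S A i j :
    optimal n S A -> 1 < i < n.-2 -> 1 < j < n.-2 -> ~~ odd i -> ~~ odd j ->
  nth 0 A i <= nth 0 A j + 1.
Proof.
move=> Aopt iI jI oi oj; rewrite leqNgt; apply/negP => lt.
have [AM _ _] := Aopt; have sA := inM_size AM; have A0 := inM_all AM.
have eij : odd i = odd j by rewrite (negPf oi) (negPf oj).
have [iA jA] : i < n /\ j < n by lia.
have le := optimal_even_spread Aopt iA jA oi oj.
have {lt le}e : nth 0 A i = nth 0 A j + 2 by lia.
have bad := optimal_shift Aopt iA jA eij (eq_leq (esym e)).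
have ij : i != j by apply: contra_eq_neq e => ->; lia.
have [iA' jA'] : i < size A /\ j < size A by rewrite sA.
rewrite -sA in iI jI.
have [al [p [q [r [s [de [mi [mj [al0 f [hp hq] [hr hs] [mi1 mj1 qs]]]]]]]]]] := bilinear_atP A0 iA' jA' ij.
move: bad; rewrite -[X in _ < K X](upd2_id iA' jA') !f e addn2 /= => bad.
(* For a gap of exactly 2 this is the strict loss under the shift. It fails at once if all weight-2
   entries are at least 2, since then [r + s <= al]. *)
have {f}bad : al + p + q < r + s by nia.
case: (boolP [exists k : 'I_n, odd k && (nth 0 A k == 1)]) => [/existsP[k /andP[ok /eqP k1]]|no]; last first.
  have P2 k : k < size A -> odd k != odd j -> 2 <= nth 0 A k.
    rewrite sA (negPf oj) => kA ok; have := inM_nth_gt0 AM kA.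
    move/existsPn/(_ (Ordinal kA)): no => /=; move: ok; case: odd => //= _; lia.
  by case: hr hs => /(_ _ P2) ? _ _ _ [/(_ _ P2) ? _ _ _]; lia.
have Q2 l : l < size A -> odd l != odd i -> nth 0 A l <= 2.
  rewrite sA (negPf oi) => lA ol.
  have := optimal_odd_spread Aopt lA (ltn_ord k) _ ok; rewrite k1; apply.
  by move: ol; case: odd.
(* If the smaller entry is at most 2, weight-1 entries are at most 4 and weight-2 entries at most 2.
   So [p, q >= al/3] and [r, s <= 5al/6], and both sides of [bad] meet at [5al/3]; a one-entry block
   is treated apart through [q = s]. *)
case: (leqP 3 (nth 0 A j)) => aj; last first.
  have P4 l : l < size A -> odd l = odd j -> nth 0 A l <= 4.
    rewrite sA => lA ol; have := optimal_even_spread Aopt lA jA _ oj.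
    by rewrite ol oj; lia.
  have P1 l : l < size A -> odd l != odd j -> 1 <= nth 0 A l.
    by rewrite sA => lA _; apply: inM_nth_gt0 AM lA.
  have p3 : al <= 3 * p by case: hp => _ h _ _; apply: (h 2) => //; lia.
  have r6 : 6 * r <= 5 * al by case: hr => _ _ h _; apply: (h 4) => //; lia.
  have [e1|ne1] := eqVneq (i - j + (j - i)).-1 1.
    by have := qs e1; case: hr => /(_ 1 P1); lia.
  have m1 : 1 < (i - j + (j - i)).-1 by lia.
  have q3 : al <= 3 * q by case: hq => _ h _ _; apply: (h 2) => //; lia.
  have s6 : 6 * s <= 5 * al by case: hs => _ _ h _; apply: (h 4) => //; lia.
  by lia.
have kA : (k : nat) < size A by rewrite sA.
have ik : i != nat_of_ord k by apply: contraNneq oi => ->.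
(* If the smaller entry is at least 3, trade 2 units of the larger one for a unit at the weight-2
   entry 1. Optimality gives [al + p + q <= 2(r+s)], while the weight-1 entries, all at least 3,
   give [r, s <= al/3]. *)
have c := @optimal_cross n S A i (nth 0 A i - 2) k 2 Aopt iA (ltn_ord k) oi ok.
have {}c : K (upd2 A i (nth 0 A i - 2) k 2) <= K A by apply: c; lia.
have P3 l : l < size A -> odd l != odd k -> 3 <= nth 0 A l.
  rewrite sA ok => lA ol; have := optimal_even_spread Aopt iA lA oi.
  by move: ol; case: odd => //= _ /(_ isT); lia.
move: {al p q r s de mi mj al0 hp hq hr hs mi1 mj1 qs bad} c.
have [al [p [q [r [s [de [mi [mj [al0 f [hp hq] [hr hs] [mi1 _ _]]]]]]]]]] := bilinear_atP A0 iA' kA ik.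
rewrite -[X in _ <= K X](upd2_id iA' kA) !f k1 e => c.
have p3 : al <= 3 * p by case: hp => _ h _ _; apply: (h 2) => //; lia.
case: hr hs => /(_ _ P3) r3 _ _ _ [/(_ _ P3) s3 _ _ s0].
have {}c : al * (nth 0 A j) + p + q <= 2 * al + 2 * (r + s) by nia.
have {}c : al + p + q <= 2 * (r + s) by nia.
(* Adjacent positions have [s = 0]; otherwise [q >= al/3]. Together with [p >= al/3], both cases are
   contradictory. *)
have [/s0|m0] := posnP (i - k + (k - i)).-1; first by lia.
have q3 : al <= 3 * q by case: hq => _ h _ _; apply: (h 2).
by lia.
Qed.

(** * Repairing an optimal sequence into M_4(n,S) *)

Lemma inM4I n S a b A :
    inM n S A -> 0 < a <= S -> 0 < b <= S ->
    (forall k, k < n -> ~~ odd k -> a <= nth 0 A k <= a.+1) ->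
    (forall k, k < n -> odd k -> b <= nth 0 A k <= b.+1) ->
  inM4 n S A.
Proof.
move=> AM /andP[a0 aS] /andP[b0 bS] ha hb; rewrite /inM4 AM /=.
have aS1 : a < S.+1 by []. have bS1 : b < S.+1 by [].
apply/existsP; exists (Ordinal aS1); apply/existsP; exists (Ordinal bS1).
rewrite /= a0 b0 /=; apply/allP => k; rewrite mem_iota add0n (inM_size AM) /= => kn.
by case: ifP => [ok|/negbT ok]; [have := hb k kn ok | have := ha k kn ok]; lia.
Qed.

(** Each term of the bilinear form at most halves: for [x >= 2], [x <= 2(x-1)] and
    [xy <= 2(x-1)(y+1)]. *)
Lemma contr_shift_half A i j :
    all (fun x => 0 < x) A -> i < size A -> j < size A -> i != j -> 1 < nth 0 A i ->
  K A <= 2 * K (upd2 A i (nth 0 A i).-1 j (nth 0 A j).+1).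
Proof.
move=> A0 iA jA ij x1.
have [al [p [q [r [s [de [_ [_ [_ f _ _ _]]]]]]]]] := bilinear_atP A0 iA jA ij.
rewrite -[X in K X <= _](upd2_id iA jA) !f.
case: (nth 0 A i) x1 => [|[|x]] //= _; move: (nth 0 A j) => y.
suff : al * (x.+2 * y) <= 2 * (al * (x.+1 * y.+1)) by nia.
by rewrite [X in _ <= X]mulnCA leq_mul2l; apply/orP; right; nia.
Qed.

(** The list [l] covers all weight-1 positions holding one of the two extreme values. Shifting a
    unit from an [a+2] to an [a] makes both [a+1] and removes a position from [l], at the cost of a
    factor 2; once an extreme value is absent, the sequence lies in M_4(n,S). *)
Lemma inM4_repair n S a b l A :
    0 < n -> 0 < a -> 0 < b <= S -> inM n S A ->
    (forall k, k < n -> odd k -> b <= nth 0 A k <= b.+1) ->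
    (forall k, k < n -> ~~ odd k -> a <= nth 0 A k <= a.+2) ->
    (forall k, k < n -> ~~ odd k -> nth 0 A k = a.+2 -> k \in l) \/
    (forall k, k < n -> ~~ odd k -> nth 0 A k = a -> k \in l) ->
  exists2 B, inM4 n S B & K A <= 2 ^ size l * K B.
Proof.
move=> n0 a0 b0; have [t] := ubnP (size l); elim: t l A => // t IH l A lt AM hb ha hl.
have pos : 0 < 2 ^ size l by rewrite expn_gt0.
case: (boolP [exists k : 'I_n, ~~ odd k && (nth 0 A k == a.+2)]) => [/existsP[i /andP[oi /eqP ia]]|no2]; last first.
  exists A; last by rewrite leq_pmull.
  apply: (@inM4I n S a b A AM _ b0 _ hb) => [|k kn ok].
    by rewrite a0; have /andP[/leq_trans->] := ha 0 n0 isT; rewrite ?(inM_nth_le _ AM).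
  by have := ha k kn ok; move/existsPn/(_ (Ordinal kn)): no2; rewrite /= ok /=; lia.
case: (boolP [exists k : 'I_n, ~~ odd k && (nth 0 A k == a)]) => [/existsP[j /andP[oj /eqP ja]]|no0]; last first.
  have ha' k : k < n -> ~~ odd k -> a.+1 <= nth 0 A k <= a.+2.
    by move=> kn ok; have := ha k kn ok; move/existsPn/(_ (Ordinal kn)): no0; rewrite /= ok /=; lia.
  exists A; last by rewrite leq_pmull.
  apply: (@inM4I n S a.+1 b A AM _ b0 ha' hb); have /andP[/leq_trans-> //] := ha' 0 n0 isT.
  by rewrite (inM_nth_le _ AM).
have sA := inM_size AM.
have ij : i != j :> nat by apply: contra_eq_neq ia => ->; rewrite ja; lia.
have [iA jA] : i < size A /\ j < size A by rewrite sA.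
set A' := upd2 A i (nth 0 A i).-1 j (nth 0 A j).+1.
have A'M : inM n S A'.
  by apply: inM_upd2; rewrite ?ltn_ord ?(negPf oi) ?(negPf oj) //; lia.
have nA' k : nth 0 A' k = if (k == j) || (k == i) then a.+1 else nth 0 A k.
  by rewrite nth_upd2 ia ja; case: eqP => //= _.
have half : K A <= 2 * K A'.
  by apply: contr_shift_half => //; [exact: inM_all AM | lia].
have [l' lt' hl'] : exists2 l', size l' < size l &
    (forall k, k < n -> ~~ odd k -> nth 0 A' k = a.+2 -> k \in l') \/
    (forall k, k < n -> ~~ odd k -> nth 0 A' k = a -> k \in l').
  case: hl => hl; [exists (filter (predC1 (val i)) l) | exists (filter (predC1 (val j)) l)].
  - have il := hl i (ltn_ord i) oi ia.
    rewrite size_filter -(count_predC (predC1 (val i)) l) -[X in X < _]addn0 ltn_add2l -has_count.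
    by apply/hasP; exists (val i); rewrite //= eqxx.
  - left=> k kn ok; rewrite nA' mem_filter /=.
    by case: ifP => [_|/negbT]; [lia | rewrite negb_or => /andP[_ ->] /hl->].
  - have jl := hl j (ltn_ord j) oj ja.
    rewrite size_filter -(count_predC (predC1 (val j)) l) -[X in X < _]addn0 ltn_add2l -has_count.
    by apply/hasP; exists (val j); rewrite //= eqxx.
  - right=> k kn ok; rewrite nA' mem_filter /=.
    by case: ifP => [_|/negbT]; [lia | rewrite negb_or => /andP[-> _] /hl->].
have [|||B BM4 KB] := IH l' A' _ A'M _ _ hl'.
- by lia.
- move=> k kn ok; rewrite nA'; case: ifP => [/orP[/eqP e|/eqP e]|_]; last exact: hb.
    by move: ok; rewrite e (negPf oj).
  by move: ok; rewrite e (negPf oi).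
- by move=> k kn ok; rewrite nA'; case: ifP => _; [lia | exact: ha].
exists B => //; apply: leq_trans half _; apply: leq_trans (leq_mul (leqnn 2) KB) _.
by rewrite mulnA -expnS leq_mul2r leq_exp2l // lt' orbT.
Qed.

Lemma class_min n S A (c : bool) :
    0 < S -> inM n S A ->
  exists2 a, 0 < a <= S & forall d,
    (forall i j, i < n -> j < n -> odd i = c -> odd j = c -> nth 0 A i <= nth 0 A j + d) ->
    forall k, k < n -> odd k = c -> a <= nth 0 A k <= a + d.
Proof.
move=> S0 AM; case: (pickP (fun k : 'I_n => odd k == c)) => [i0 i0c|no]; last first.
  (* The class is empty here, as happens for odd positions when [n = 1]; any value from 1 to [S]
     would do. *)
  by exists 1 => // d _ k kn kc; have := no (Ordinal kn); rewrite /= kc eqxx.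
case: (@arg_minnP _ i0 (fun k : 'I_n => odd k == c) (fun k => nth 0 A k) i0c) => i /eqP ic imin.
exists (nth 0 A i); first by rewrite (inM_nth_gt0 AM) ?(inM_nth_le _ AM).
move=> d hd k kn kc; rewrite hd // andbT.
by apply: (imin (Ordinal kn)); rewrite /= kc.
Qed.

Lemma optimal_le_inM4 n S A :
  0 < n -> 0 < S -> optimal n S A -> exists2 B, inM4 n S B & K A <= 4 * K B.
Proof.
move=> n0 S0 Aopt; have [AM _ _] := Aopt.
have [a a0 ha] := class_min false S0 AM; have [b b0 hb] := class_min true S0 AM.
have {}hb k : k < n -> odd k -> b <= nth 0 A k <= b.+1.
  by move=> kn ok; rewrite -addn1; apply: hb => // i j *; apply: optimal_odd_spread Aopt _ _ _ _.
have {}ha k : k < n -> ~~ odd k -> a <= nth 0 A k <= a.+2.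
  move=> kn /negPf ok; rewrite -addn2; apply: ha => // i j ? ? oi oj.
  by apply: optimal_even_spread Aopt _ _ _ _; rewrite ?oi ?oj.
(* the only even positions not covered by [optimal_even_interior] *)
pose l := [:: 0; n.-1./2.*2].
have out k : k < n -> ~~ odd k -> k \notin l -> 1 < k < n.-2.
  by rewrite !inE negb_or => kn ok /andP[? ?]; lia.
apply: (@inM4_repair n S a b l A) => //; first by case/andP: a0.
(* Interior entries differ by at most 1, so [a] and [a+2] cannot both occur outside [l]. As [l] has
   two members, the loss is at most [2 ^ 2 = 4]. *)
case: (boolP [exists k : 'I_n, [&& ~~ odd k, val k \notin l & nth 0 A k == a.+2]]) => [|no].
  case/existsP => i /and3P[oi il /eqP ia]; right=> k kn ok ka.
  apply/negPn/negP => kl.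
  by have := optimal_even_interior Aopt (out i (ltn_ord i) oi il) (out k kn ok kl) oi ok; rewrite ia ka; lia.
left=> k kn ok ka; apply/negPn/negP => kl.
by move/existsPn/(_ (Ordinal kn)): no; rewrite /= ok kl ka eqxx.
Qed.

Lemma maxM_bounds n S :
    0 < n -> 0 < S -> (exists A, inM n S A) ->
  [/\ maxM4 n S <= maxM n S, maxM n S <= 4 * maxM4 n S & 0 < maxM4 n S].
Proof.
move=> n0 S0 [A0 A0M]; have [A Aopt] := optimal_exists A0M.
have [AM Amax _] := Aopt; have [B BM4 KB] := optimal_le_inM4 n0 S0 Aopt.
have BM : inM n S B by case/andP: BM4.
have KA := contr_gt0 (inM_all AM).
have BM4max : K B <= maxM4 n S.
  rewrite -(contr_rev B) -/(cont B) /maxM4.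
  by apply: (@leq_bigmax_seq _ _ (inM4 n S) cont) => //; apply: candidatesP.
split; last by lia.
- apply/bigmax_leqP_seq => C Cc /andP[CM _].
  exact: (@leq_bigmax_seq _ _ (inM n S) cont).
- apply: (@leq_trans (K A)); last by lia.
  by apply/bigmax_leqP_seq => C Cc CM; rewrite /cont contr_rev; apply: Amax.
Qed.

(* Passage to the real quotient *)
From Stdlib Require Import Reals Lra.
Open Scope R_scope.

Theorem theorem1 :
  exists c1 c2 : R, 0 < c1 /\ 0 < c2 /\
    forall n S : nat, (0 < n)%nat -> (0 < S)%nat ->
      (exists A : seq nat, inM n S A) ->
      c1 <= INR (maxM n S) / INR (maxM4 n S) <= c2.
Proof.
exists 1, 4; split; [lra | split; [lra |]] => n S n0 S0 hM.
have [/leP/le_INR le1 /leP/le_INR le2 /ltP/lt_0_INR pos] := maxM_bounds n0 S0 hM.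
rewrite mult_INR (_ : INR 4 = 4) in le2; last by rewrite /=; lra.
have e : INR (maxM n S) / INR (maxM4 n S) * INR (maxM4 n S) = INR (maxM n S) by field; lra.
by split; apply: (Rmult_le_reg_r _ _ _ pos); rewrite e; lra.
Qed.
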